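(* Let $K_p,K_d,K_i\in\mathbb{R}^{m\times p}$ be such that the closed loop of the system $$\dot x(t)=A_0x(t)+\sum_{k=1}^{K}A_kx(t-\tau_k)+Bu(t),\qquad y(t)=Cx(t),$$ with the PID control law $$u(t)=K_p\,y(t)+K_d\,\dot y(t)+K_i\int_0^t y(s)\,ds$$ is exponentially stable. Let $$S=\left\{\lambda\in\mathbb{C}:\ \Im(\lambda)\in(-\pi,\pi)\ \text{ and }\ \Re(\lambda)<\begin{cases}\Im(\lambda)\cot(\Im(\lambda)),&\Im(\lambda)\in(-\pi,0)\cup(0,\pi),\\ 1,&\Im(\lambda)=0\end{cases}\right\}$$ and let $\mathrm{clos}(S)$ be its closure in $\mathbb{C}$. If at least one of the eigenvalues of $BK_dC$ lies outside $\mathrm{clos}(S)$, then there exists $\hat r>0$ such that, for all $r\in(0,\hat r)$, the closed loop of the same system with the control law $$u(t)=K_p\,y(t)+K_d\,\frac{y(t)-y(t-r)}{r}+K_i\int_0^t y(s)\,ds$$ is unstable.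
   Context: Data: $x(t)\in\mathbb{R}^n$, $u(t)\in\mathbb{R}^m$, $y(t)\in\mathbb{R}^p$; discrete delays $0<\tau_1<\dots<\tau_K<+\infty$; real matrices $A_0,\dots,A_K\in\mathbb{R}^{n\times n}$, $B\in\mathbb{R}^{n\times m}$ of full column rank, $C\in\mathbb{R}^{p\times n}$ of full row rank. Let $q=\operatorname{rank}(K_i)$ and $K_i=U_iV_i$ with $U_i\in\mathbb{R}^{m\times q}$ of full column rank and $V_i\in\mathbb{R}^{q\times p}$ of full row rank (blocks of size $q$ are absent if $q=0$). Characteristic function of the nominal closed loop: $$H_0(\lambda)=\det\left(\lambda\begin{bmatrix}I_n-BK_dC&0\\0&I_q\end{bmatrix}-\begin{bmatrix}A_0+BK_pC&BU_i\\ V_iC&0\end{bmatrix}-\sum_{k=1}^{K}\begin{bmatrix}A_k&0\\0&0\end{bmatrix}e^{-\lambda\tau_k}\right).$$ Characteristic function of the closed loop with the finite-difference control law: $$H_2(\lambda;r)=\det\left(\lambda\begin{bmatrix}I_n&0\\0&I_q\end{bmatrix}-\begin{bmatrix}BK_dC&0\\0&0\end{bmatrix}\frac{1-e^{-\lambda r}}{r}-\begin{bmatrix}A_0+BK_pC&BU_i\\ V_iC&0\end{bmatrix}-\sum_{k=1}^{K}\begin{bmatrix}A_k&0\\0&0\end{bmatrix}e^{-\lambda\tau_k}\right).$$ A closed loop is exponentially stable if and only if all roots of its characteristic function lie in the open left half-plane, bounded away from the imaginary axis (i.e. there is $c>0$ such that all roots satisfy $\Re(\lambda)\le -c$). It is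 unstable if its characteristic function has at least one root in the open right half-plane. *)

(* Defs.v *)
From mathcomp Require Export all_boot all_order all_algebra.
From mathcomp Require Export all_classical all_reals all_analysis.
From mathcomp Require Export complex.
Set Implicit Arguments.
Unset Strict Implicit.
Unset Printing Implicit Defensive.
Export Order.TTheory GRing.Theory Num.Theory.
Export numFieldNormedType.Exports.
Local Open Scope classical_set_scope.
Local Open Scope ring_scope.
Local Open Scope complex_scope.

Definition cexp (R : realType) (z : R[i]) : R[i] :=
  (expR (complex.Re z))%:C
    * (cos (complex.Im z) +i* sin (complex.Im z)).

Definition cot (R : realType) (x : R) : R := cos x / sin x.

Definition cmx (R : realType) (a b : nat) (M : 'M[R]_(a, b)) :
  'M[R[i]]_(a, b) := map_mx (real_complex R) M.

(* The closed loops live on R^n x R^q, where q = rank Ki and Ki = U V: the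
   last q coordinates are the state of the integral action. In both
   characteristic functions A0 is the undelayed matrix and A k is paired with
   the delay tau k. *)
Definition loop_mx (R : realType) (n m p q : nat)
    (A0 : 'M[R]_n) (B : 'M[R]_(n, m)) (C : 'M[R]_(p, n)) (Kp : 'M[R]_(m, p))
    (U : 'M[R]_(m, q)) (V : 'M[R]_(q, p)) : 'M[R]_(n + q) :=
  block_mx (A0 + B *m Kp *m C) (B *m U) (V *m C) 0.

Definition delay_mx (R : realType) (n K : nat) (q : nat)
    (A : 'I_K -> 'M[R]_n) (tau : 'I_K -> R) (lambda : R[i]) :
    'M[R[i]]_(n + q) :=
  \sum_(k < K) cexp (- lambda * (tau k)%:C)
                 *: cmx (block_mx (A k) 0 0 (0 : 'M[R]_q)).

(* H_0, the nominal PID closed loop. *)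
Definition charfun_pid (R : realType) (n m p q K : nat)
    (A0 : 'M[R]_n) (A : 'I_K -> 'M[R]_n) (tau : 'I_K -> R)
    (B : 'M[R]_(n, m)) (C : 'M[R]_(p, n)) (Kp Kd : 'M[R]_(m, p))
    (U : 'M[R]_(m, q)) (V : 'M[R]_(q, p)) (lambda : R[i]) : R[i] :=
  \det (lambda *: cmx (block_mx (1%:M - B *m Kd *m C) 0 0 (1%:M : 'M[R]_q))
        - cmx (loop_mx A0 B C Kp U V)
        - delay_mx q A tau lambda).

(* H_2, with dy/dt replaced by the difference quotient over [t - r, t]. *)
Definition charfun_fd (R : realType) (n m p q K : nat)
    (A0 : 'M[R]_n) (A : 'I_K -> 'M[R]_n) (tau : 'I_K -> R)
    (B : 'M[R]_(n, m)) (C : 'M[R]_(p, n)) (Kp Kd : 'M[R]_(m, p))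
    (U : 'M[R]_(m, q)) (V : 'M[R]_(q, p)) (r : R) (lambda : R[i]) : R[i] :=
  \det (lambda *: cmx (block_mx (1%:M : 'M[R]_n) 0 0 (1%:M : 'M[R]_q))
        - ((1 - cexp (- lambda * r%:C)) / r%:C)
            *: cmx (block_mx (B *m Kd *m C) 0 0 (0 : 'M[R]_q))
        - cmx (loop_mx A0 B C Kp U V)
        - delay_mx q A tau lambda).

(* Stability notions of a closed loop, in terms of its characteristic
   function H. *)
Definition exp_stable (R : realType) (H : R[i] -> R[i]) : Prop :=
  exists2 c : R, 0 < c &
    forall lambda : R[i], H lambda = 0 -> complex.Re lambda <= - c.

Definition unstable (R : realType) (H : R[i] -> R[i]) : Prop :=
  exists2 lambda : R[i], H lambda = 0 & 0 < complex.Re lambda.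

(* R[i]^o is R[i] with the topology of its modulus, i.e. the usual topology of
   the complex plane; the bare type R[i] carries no canonical topology. *)
Definition setS (R : realType) : set (R[i]^o) :=
  [set lambda : R[i] |
     [/\ - pi < complex.Im lambda, complex.Im lambda < pi
       & complex.Re lambda <
           if complex.Im lambda == 0 then 1
           else complex.Im lambda * cot (complex.Im lambda)]].

(* Main.v *)
Require Import Defs.
From mathcomp Require Import perm ring lra.
Set Implicit Arguments.
Unset Strict Implicit.
Unset Printing Implicit Defensive.
Local Open Scope classical_set_scope.
Local Open Scope ring_scope.
Local Open Scope complex_scope.

(**
Write M = B Kd C and substitute lambda = z / r. Multiplying the characteristic
matrix by r turns it into
  z I - (1 - e^-z) diag(M, 0) - r (L + sum_k e^(-z tau_k / r) A_k),
and for Re z >= 0 the exponentials of the last term have modulus at most 1. So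
on bounded parts of the right half-plane the determinants converge uniformly,
as r tends to 0, to z^q det (z I - (1 - e^-z) M). A zero z0 of this limit with
Re z0 > 0 attracts zeros z_r of the perturbed determinants (Hurwitz), and
z_r / r is then a characteristic root with positive real part.

Existence of z0 (delay_root_right). An eigenvalue mu of M contributes the
equation z = mu (1 - e^-z). With v = - mu and w = z - mu it reads
w e^w = v e^v, and z has positive real part when Re w > Re v: it must be shown
that v is not the rightmost solution. The complement of clos S is exactly where
arg v + |Im v| exceeds pi (up to conjugation, and apart from the real axis).
Points of the level curve |w| e^(Re w) = |v| e^(Re v) are parametrized by their
real part x; the angle arg w + Im w of w e^w is 0 at the rightmost point and
more than pi at v, so by the intermediate value theorem every angle in [0, pi]
is attained strictly to the right of v. Modulo 2 pi and conjugation, this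
includes the angle of v e^v.

Hurwitz's theorem (hurwitz_root) is obtained without contour integrals. All
functions involved are uniform limits of polynomials on bounded sets
(poly_approx): e^(a z) is the limit of (1 + a z / N)^N, and determinants inherit
the property since the determinant is Lipschitz on bounded sets of matrices.
For a nonconstant polynomial, d'Alembert's descent (horner_descent) shows that a
nonzero value is never a local minimum of the modulus; so a modulus smaller at
the centre of a disc than on the bounding circle forces a root in the disc.
This passes to uniform limits by compactness.

Finally z0 has to be an isolated zero of the limit determinant
(limit_det_isolated): nearby zeros have z / (1 - e^-z) equal to an eigenvalue
close to mu, hence to mu itself, and the zeros of z - mu (1 - e^-z) are isolated
(delay_root_isolated).
*)

(** * Modulus and compactness in the complex plane *)

(** The norm of R[i] takes its values in R[i] itself; a modulus with values in R
makes the inequalities below linear arithmetic over an ordered field. *)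
Definition cmod (R : realType) (z : R[i]) : R :=
  Num.sqrt (complex.Re z ^+ 2 + complex.Im z ^+ 2).

Lemma cmod_normc (R : realType) (z : R[i]) :
  cmod z = ComplexField.Normc.normc z.
Proof. by case: z. Qed.

Lemma normcC_cmod (R : realType) (z : R[i]) : `|z| = (cmod z)%:C.
Proof. by rewrite normc_def. Qed.

Lemma cmod_ge0 (R : realType) (z : R[i]) : 0 <= cmod z.
Proof. exact: sqrtr_ge0. Qed.

Lemma cmod0 (R : realType) : cmod (0 : R[i]) = 0.
Proof. by rewrite cmod_normc ComplexField.Normc.normc0. Qed.

Lemma cmod1 (R : realType) : cmod (1 : R[i]) = 1.
Proof. by rewrite cmod_normc ComplexField.Normc.normc1. Qed.

Lemma cmod_eq0 (R : realType) (z : R[i]) : (cmod z == 0) = (z == 0).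
Proof.
apply/eqP/eqP => [|->]; last exact: cmod0.
by rewrite cmod_normc => /ComplexField.Normc.eq0_normc.
Qed.

Lemma cmod_gt0 (R : realType) (z : R[i]) : (0 < cmod z) = (z != 0).
Proof. by rewrite lt0r cmod_ge0 andbT cmod_eq0. Qed.

Lemma cmodM (R : realType) (z w : R[i]) : cmod (z * w) = cmod z * cmod w.
Proof. by rewrite !cmod_normc ComplexField.Normc.normcM. Qed.

Lemma cmodV (R : realType) (z : R[i]) : cmod z^-1 = (cmod z)^-1.
Proof. by rewrite !cmod_normc ComplexField.Normc.normcV. Qed.

Lemma cmodX (R : realType) (z : R[i]) k : cmod (z ^+ k) = cmod z ^+ k.
Proof. by elim: k => [|k IH]; rewrite ?expr0 ?cmod1// !exprS cmodM IH. Qed.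

Lemma cmodN (R : realType) (z : R[i]) : cmod (- z) = cmod z.
Proof. by rewrite /cmod; case: z => a b /=; rewrite !sqrrN. Qed.

Lemma cmod_le_add (R : realType) (z w : R[i]) :
  cmod (z + w) <= cmod z + cmod w.
Proof. by rewrite !cmod_normc; exact: le_normcD. Qed.

Lemma cmod_distC (R : realType) (z w : R[i]) : cmod (z - w) = cmod (w - z).
Proof. by rewrite -cmodN opprB. Qed.

Lemma cmod_le_sub (R : realType) (z w : R[i]) :
  cmod (z - w) <= cmod z + cmod w.
Proof. by rewrite -[cmod w]cmodN; exact: cmod_le_add. Qed.

Lemma cmod_sub_le (R : realType) (z w : R[i]) :
  cmod z - cmod w <= cmod (z - w).
Proof.
by have := cmod_le_add (z - w) w; rewrite subrK lerBlDr.
Qed.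

Lemma cmodR (R : realType) (x : R) : cmod x%:C = `|x|.
Proof. by rewrite /cmod /= expr0n addr0 sqrtr_sqr. Qed.

Lemma le_Re_cmod (R : realType) (z : R[i]) : `|complex.Re z| <= cmod z.
Proof. by rewrite -sqrtr_sqr ler_wsqrtr// lerDl sqr_ge0. Qed.

Lemma le_Im_cmod (R : realType) (z : R[i]) : `|complex.Im z| <= cmod z.
Proof. by rewrite -sqrtr_sqr ler_wsqrtr// lerDr sqr_ge0. Qed.

Lemma cmod_le_ReIm (R : realType) (z : R[i]) :
  cmod z <= `|complex.Re z| + `|complex.Im z|.
Proof.
rewrite -[leRHS]ger0_norm ?addr_ge0// -sqrtr_sqr ler_wsqrtr//.
rewrite sqrrD !real_normK ?num_real//.
have : 0 <= `|complex.Re z| * `|complex.Im z| by rewrite mulr_ge0.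
by move=> ?; lra.
Qed.

Lemma cmod_sum (R : realType) (I : finType) (P : pred I) (F : I -> R[i]) :
  cmod (\sum_(i | P i) F i) <= \sum_(i | P i) cmod (F i).
Proof.
apply: (big_ind2 (fun z (x : R) => cmod z <= x)) => //.
- by rewrite cmod0.
- by move=> z x w y hz hw; apply: le_trans (cmod_le_add _ _) _; exact: lerD.
Qed.

(** An epsilon-delta form in terms of cmod; ccontinuous_plane transfers it to
R * R, where the compact sets are described by their coordinates. *)
Definition ccontinuous (R : realType) (f : R[i] -> R[i]) : Prop :=
  forall z (e : R), 0 < e -> exists2 d : R, 0 < d &
    forall w, cmod (w - z) < d -> cmod (f w - f z) < e.

Lemma ccontinuous_plane (R : realType) (f : R[i] -> R[i]) :
  ccontinuous f -> continuous (fun u : R * R => cmod (f (u.1 +i* u.2))).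
Proof.
move=> cf [x y]; apply/cvgrPdist_lt => e e0.
have [d d0 fd] := cf (x +i* y) e e0.
have d20 : 0 < d / 2 by rewrite divr_gt0.
near=> u.
have u1 : `|x - u.1| < d / 2.
  near: u.
  have : (fun u : R * R => u.1) u @[u --> (x, y)] --> x by exact: cvg_fst.
  by move/cvgrPdist_lt => /(_ _ d20).
have u2 : `|y - u.2| < d / 2.
  near: u.
  have : (fun u : R * R => u.2) u @[u --> (x, y)] --> y by exact: cvg_snd.
  by move/cvgrPdist_lt => /(_ _ d20).
set w := u.1 +i* u.2; set z := x +i* y.
have wz : cmod (w - z) < d.
  apply: le_lt_trans (cmod_le_ReIm _) _.
  rewrite /w /z /= distrC [X in _ + X]distrC.
  by rewrite [d]splitr ltrD.
have := fd _ wz; rewrite -/z.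
have h1 := cmod_sub_le (f w) (f z).
have h2 := cmod_sub_le (f z) (f w).
rewrite cmod_distC in h2 => h3.
by rewrite ltr_norml; apply/andP; split; lra.
Unshelve. all: by end_near.
Qed.

(** Closed discs (a = 0) and circles (a = b) are both needed, hence annuli: they
are compact as closed subsets of a square. *)
Lemma annulus_min (R : realType) (f : R[i] -> R[i]) (z0 : R[i]) (a b : R) :
  0 <= a -> a <= b -> ccontinuous f ->
  exists2 w, a <= cmod (w - z0) <= b &
    forall z, a <= cmod (z - z0) <= b -> cmod (f w) <= cmod (f z).
Proof.
move=> a0 ab cf.
pose g (u : R * R) := cmod (u.1 +i* u.2 - z0).
have cg : continuous g.
  apply: (@ccontinuous_plane R (fun z => z - z0)) => z e e0.
  by exists e => // w; rewrite opprB addrA subrK.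
pose x0 := complex.Re z0; pose y0 := complex.Im z0.
pose A := (`[x0 - b, x0 + b] `*` `[y0 - b, y0 + b]) `&` (g @^-1` `[a, b]).
have cA : compact A.
  apply: compact_closedI.
    by apply: compact_setX; exact: segment_compact.
  by apply: closed_comp; [move=> u _; exact: cg | exact: itv_closed].
have Ab z : a <= cmod (z - z0) <= b -> (complex.Re z, complex.Im z) \in A.
  move=> /andP[az zb]; apply/mem_set; split.
    have := le_Re_cmod (z - z0); have := le_Im_cmod (z - z0).
    rewrite !raddfB/= -/x0 -/y0.
    move=> /le_trans/(_ zb); rewrite ler_norml => /andP[? ?].
    move=> /le_trans/(_ zb); rewrite ler_norml => /andP[? ?].
    by split; rewrite /= in_itv/=; apply/andP; split; lra.
  by rewrite /= in_itv/= /g/=; case: z az zb => x y /= -> ->.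
have hb : cmod (z0 + b%:C - z0) = b.
  by rewrite addrAC subrr add0r cmodR ger0_norm// (le_trans a0).
have A0 : A !=set0.
  exists (complex.Re (z0 + b%:C), complex.Im (z0 + b%:C)).
  by apply: set_mem; apply: Ab; rewrite hb ab lexx.
have [|u uA um] := @compact_EVT_min _ R
    (fun u : R * R => cmod (f (u.1 +i* u.2))) A A0 cA.
  by apply: continuous_subspaceT; exact: ccontinuous_plane.
exists (u.1 +i* u.2).
  by move: uA => /set_mem[_]; rewrite /= in_itv.
by move=> z /Ab /um /=; case: z.
Qed.

(** * Roots of complex polynomials in a disc *)

Lemma horner_bounded (R : realType) (p : {poly R[i]}) (M : R) :
  exists2 L : R, 0 <= L & forall z, cmod z <= M -> cmod p.[z] <= L.
Proof.
elim/poly_ind: p => [|p c [L L0 hL]].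
  by exists 0 => // z _; rewrite horner0 cmod0.
exists (L * `|M| + cmod c) => [|z zM].
  by rewrite addr_ge0 ?mulr_ge0 ?cmod_ge0.
rewrite hornerMXaddC; apply: le_trans (cmod_le_add _ _) _.
rewrite lerD2r cmodM ler_pM ?cmod_ge0 ?hL//.
exact: le_trans (ler_norm _).
Qed.

Lemma horner_lipschitz (R : realType) (p : {poly R[i]}) (M : R) :
  exists2 L : R, 0 <= L & forall z w, cmod z <= M -> cmod w <= M ->
    cmod (p.[z] - p.[w]) <= L * cmod (z - w).
Proof.
elim/poly_ind: p => [|p c [L L0 hL]].
  by exists 0 => // z w _ _; rewrite !horner0 subrr cmod0 mul0r.
have [B B0 hB] := horner_bounded p M.
exists (L * `|M| + B) => [|z w zM wM]; first by rewrite addr_ge0 ?mulr_ge0.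
have -> : (p * 'X + c%:P).[z] - (p * 'X + c%:P).[w]
    = (p.[z] - p.[w]) * z + p.[w] * (z - w) by rewrite !hornerMXaddC; ring.
apply: le_trans (cmod_le_add _ _) _; rewrite !cmodM mulrDl lerD//.
  rewrite mulrAC ler_pM ?cmod_ge0 ?hL//; exact: le_trans (ler_norm _).
by rewrite ler_wpM2r ?cmod_ge0 ?hB.
Qed.

Lemma horner_ccontinuous (R : realType) (p : {poly R[i]}) :
  ccontinuous (horner p).
Proof.
move=> z e e0; have [L L0 hL] := horner_lipschitz p (cmod z + 1).
exists (Num.min 1 (e / (L + 1))).
  by rewrite lt_min ltr01 divr_gt0// ltr_wpDl.
move=> w; rewrite lt_min => /andP[w1 we].
have hw : cmod w <= cmod z + 1.
  by have := cmod_sub_le w z; lra.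
apply: le_lt_trans (hL _ _ hw _) _; first by rewrite lerDl.
move: we; rewrite ltr_pdivlMr ?ltr_wpDl// => we.
by have := cmod_ge0 (w - z); nra.
Qed.

(** Near z0, p = c + (X - z0)^k q with q(z0) <> 0 and k > 0. Moving from z0 along
a direction zt with zt^k q(z0) = - c makes the leading variation point from c
towards 0. *)
Lemma horner_descent (R : realType) (p : {poly R[i]}) (z0 : R[i]) (e : R) :
  (1 < size p)%N -> p.[z0] != 0 -> 0 < e ->
  exists2 z, cmod (z - z0) < e & cmod p.[z] < cmod p.[z0].
Proof.
move=> sp c0 e0; set c := p.[z0].
have pc0 : p - c%:P != 0.
  rewrite subr_eq0; apply: contraTneq sp => ->.
  by rewrite -leqNgt size_polyC leq_b1.
have [k [q]] := multiplicity_XsubC (p - c%:P) z0.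
rewrite pc0/= => qz0 pq.
have k0 : (0 < k)%N.
  rewrite lt0n; apply/eqP => k0; move/(congr1 (horner^~ z0)): pq.
  rewrite k0 expr0 mulr1 hornerD hornerN hornerC subrr => /esym q0.
  by move: qz0; rewrite /root q0 eqxx.
have hp h : p.[z0 + h] = c + q.[z0 + h] * h ^+ k.
  move/(congr1 (horner^~ (z0 + h))): pq.
  rewrite hornerD hornerN hornerC hornerM horner_exp hornerXsubC.
  by rewrite (addrC z0) addrK => <-; rewrite (addrC c) subrK.
pose zt := k.-root (- c / q.[z0]).
have ztk : zt ^+ k * q.[z0] = - c by rewrite rootCK// divfK.
have q0 : 0 < cmod q.[z0] by rewrite cmod_gt0.
have q20 : 0 < cmod q.[z0] / 2 by rewrite divr_gt0.
have [d d0 qd] := horner_ccontinuous q z0 q20.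
pose m := Num.min d e.
have m0 : 0 < m by rewrite lt_min d0.
have zt0 : 0 <= cmod zt := cmod_ge0 zt.
(* This choice gives both s <= 1 and s |zt| < m. *)
pose s := m / (m + cmod zt + 1).
have den0 : 0 < m + cmod zt + 1 by lra.
have s0 : 0 < s by rewrite divr_gt0.
have s1 : s <= 1 by rewrite ler_pdivrMr// mul1r; lra.
have szt : cmod (s%:C * zt) < m.
  rewrite cmodM cmodR gtr0_norm// /s mulrAC ltr_pdivrMr//.
  by rewrite ltr_pM2l//; lra.
exists (z0 + s%:C * zt).
  rewrite addrAC subrr add0r; apply: lt_le_trans szt _.
  by rewrite ge_min lexx orbT.
have -> : p.[z0 + s%:C * zt] = c * (1 - s ^+ k)%:C
    + (s ^+ k)%:C * (zt ^+ k * (q.[z0 + s%:C * zt] - q.[z0])).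
  rewrite hp exprMn mulrBr ztk rmorphB/= rmorphXn/= rmorph1; ring.
apply: le_lt_trans (cmod_le_add _ _) _.
have sk0 : 0 < s ^+ k by rewrite exprn_gt0.
have sk1 : s ^+ k <= 1 by rewrite exprn_ile1// ltW.
rewrite !cmodM !cmodR (gtr0_norm sk0) ger0_norm ?subr_ge0//.
have : cmod (q.[z0 + s%:C * zt] - q.[z0]) < cmod q.[z0] / 2.
  apply: qd; rewrite addrAC subrr add0r; apply: lt_le_trans szt _.
  by rewrite ge_min lexx.
have : cmod (zt ^+ k) * cmod q.[z0] = cmod c by rewrite -cmodM ztk cmodN.
have zk0 := cmod_ge0 (zt ^+ k).
have cc0 : 0 < cmod c by rewrite cmod_gt0.
set X := cmod (zt ^+ k) in zk0 *; set Y := cmod (_ - _); set Z := cmod q.[z0].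
move=> XZ YZ.
have : X * Y <= cmod c / 2 by rewrite -XZ -mulrA ler_wpM2l// ltW.
by move: (cmod c) (s ^+ k) sk0 sk1 cc0 => C S; clear; nra.
Qed.

(** The minimum of |p| over the disc is not on the circle, and in the interior a
nonzero minimum contradicts the descent step. *)
Lemma poly_root_in_disc (R : realType) (p : {poly R[i]}) (z0 : R[i]) (rho : R) :
  0 < rho ->
  (forall z, cmod (z - z0) = rho -> cmod p.[z0] < cmod p.[z]) ->
  exists2 z, cmod (z - z0) <= rho & p.[z] = 0.
Proof.
move=> rho0 hb.
have [w /andP[_ wr] wm] :=
  annulus_min z0 (lexx 0) (ltW rho0) (@horner_ccontinuous R p).
have pw : cmod p.[w] <= cmod p.[z0].
  by apply: wm; rewrite subrr cmod0 lexx ltW.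
have [/eqP|pw0] := boolP (p.[w] == 0); first by exists w.
have sp : (1 < size p)%N.
  rewrite ltnNge; apply/negP => /size1_polyC pC.
  have /hb : cmod (z0 + rho%:C - z0) = rho.
    by rewrite addrAC subrr add0r cmodR gtr0_norm.
  by rewrite pC !hornerC ltxx.
have wr' : cmod (w - z0) < rho.
  rewrite lt_neqAle wr andbT; apply/eqP => /hb.
  by rewrite ltNge pw.
have [|z zw pz] := @horner_descent R p w (rho - cmod (w - z0)) sp pw0.
  by rewrite subr_gt0.
have zr : cmod (z - z0) <= rho.
  have -> : z - z0 = (z - w) + (w - z0) by ring.
  by apply: le_trans (cmod_le_add _ _) _; lra.
by have := wm z; rewrite cmod_ge0 zr => /(_ isT); rewrite leNgt pz.
Qed.

(** * Uniform limits of polynomials and Hurwitz's theorem *)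

(** The functions that are uniform limits of polynomials on bounded sets are the
entire functions; this form gives what is needed of them without power series
or contour integrals. *)
Definition poly_approx (R : realType) (f : R[i] -> R[i]) : Prop :=
  forall M e : R, 0 < e -> exists p : {poly R[i]},
    forall z, cmod z <= M -> cmod (f z - p.[z]) <= e.

Lemma poly_approx_continuous (R : realType) (f : R[i] -> R[i]) :
  poly_approx f -> ccontinuous f.
Proof.
move=> hf z e e0; have e40 : 0 < e / 4 by rewrite divr_gt0.
have [p hp] := hf (cmod z + 1) _ e40.
have [d d0 pd] := horner_ccontinuous p z e40.
exists (Num.min 1 d); first by rewrite lt_min ltr01.
move=> w; rewrite lt_min => /andP[w1 /pd pw].
have hw : cmod w <= cmod z + 1.
  by have := cmod_sub_le w z; lra.
have /hp fz : cmod z <= cmod z + 1 by rewrite lerDl.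
have fw := hp _ hw.
have -> : f w - f z = (f w - p.[w]) + (p.[w] - p.[z]) - (f z - p.[z]) by ring.
apply: le_lt_trans (cmod_le_sub _ _) _.
by have := cmod_le_add (f w - p.[w]) (p.[w] - p.[z]); lra.
Qed.

Lemma poly_approx_bounded (R : realType) (f : R[i] -> R[i]) (M : R) :
  poly_approx f ->
  exists2 L : R, 0 <= L & forall z, cmod z <= M -> cmod (f z) <= L.
Proof.
move=> hf; have [p hp] := hf M 1 ltr01.
have [L L0 hL] := horner_bounded p M.
exists (L + 1) => [|z zM]; first by rewrite addr_ge0.
have := cmod_sub_le (f z) p.[z]; have := hp _ zM; have := hL _ zM.
by lra.
Qed.

(** Good polynomial approximations still satisfy the hypothesis of
poly_root_in_disc, so they have roots in the disc; hence the minimum of |f| over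
the disc is arbitrarily small. *)
Lemma poly_approx_root_in_disc (R : realType) (f : R[i] -> R[i]) (z0 : R[i])
    (rho m : R) :
  poly_approx f -> 0 < rho -> cmod (f z0) < m ->
  (forall z, cmod (z - z0) = rho -> m <= cmod (f z)) ->
  exists2 z, cmod (z - z0) <= rho & f z = 0.
Proof.
move=> hf rho0 fm hb.
have [w /andP[_ wr] wm] :=
  annulus_min z0 (lexx 0) (ltW rho0) (poly_approx_continuous hf).
exists w => //; apply/eqP; rewrite -cmod_eq0 eq_le cmod_ge0 andbT leNgt.
apply/negP => fw0.
pose e := Num.min (cmod (f w) / 2) ((m - cmod (f z0)) / 3).
have e0 : 0 < e by rewrite lt_min !divr_gt0// subr_gt0.
have [p hp] := hf (cmod z0 + rho) e e0.
have e1 : e <= cmod (f w) / 2 by rewrite ge_min lexx.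
have e2 : e <= (m - cmod (f z0)) / 3 by rewrite ge_min lexx orbT.
have {}hp z : cmod (z - z0) <= rho -> cmod (f z - p.[z]) <= e.
  by move=> zr; apply: hp; have := cmod_sub_le z z0; lra.
have [|z zr pz] := @poly_root_in_disc R p z0 rho rho0.
  move=> z zr.
  have h1 : cmod (f z - p.[z]) <= e by apply: hp; rewrite zr.
  have h2 : cmod (f z0 - p.[z0]) <= e by apply: hp; rewrite subrr cmod0 ltW.
  have h3 := cmod_sub_le (f z) (f z - p.[z]); rewrite subKr in h3.
  have := cmod_sub_le p.[z0] (f z0); rewrite cmod_distC => h4.
  by have := hb _ zr; lra.
have := hp _ zr; rewrite pz subr0 => fz.
by have := wm z; rewrite cmod_ge0 zr => /(_ isT); lra.
Qed.

(** On the circle |F| is bounded below by compactness; as soon as G r is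
within a third of this bound of F, poly_approx_root_in_disc applies to G r. *)
Lemma hurwitz_root (R : realType) (F : R[i] -> R[i]) (G : R -> R[i] -> R[i])
    (z0 : R[i]) (rho : R) :
  poly_approx F -> (forall r, 0 < r -> poly_approx (G r)) ->
  0 < rho -> F z0 = 0 ->
  (forall z, cmod (z - z0) = rho -> F z != 0) ->
  (forall e : R, 0 < e -> exists2 rhat : R, 0 < rhat &
     forall r z, 0 < r -> r < rhat -> cmod (z - z0) <= rho ->
       cmod (G r z - F z) <= e) ->
  exists2 rhat : R, 0 < rhat & forall r, 0 < r -> r < rhat ->
    exists2 z, cmod (z - z0) <= rho & G r z = 0.
Proof.
move=> hF hG rho0 Fz0 Fb GF.
have [w wr wm] :=
  annulus_min z0 (ltW rho0) (lexx rho) (poly_approx_continuous hF).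
have Fw0 : 0 < cmod (F w) by
  rewrite cmod_gt0 Fb//; apply: le_anti; rewrite andbC.
have [|rhat rhat0 h] := GF (cmod (F w) / 3); first by rewrite divr_gt0.
exists rhat => // r r0 rr.
apply: (@poly_approx_root_in_disc R (G r) z0 rho (cmod (F w) / 2)) => //.
- exact: hG.
- have := h r z0 r0 rr; rewrite subrr cmod0 Fz0 subr0 => /(_ (ltW rho0)).
  by lra.
- move=> z zr; have := h r z r0 rr; rewrite zr lexx => /(_ isT) h1.
  have := wm z; rewrite zr lexx => /(_ isT).
  have := cmod_sub_le (F z) (G r z); rewrite cmod_distC.
  by lra.
Qed.

(** * The complex exponential *)

(** The mean value theorem for sin on [0, y], in the form from which all
estimates of sin below follow. *)
Lemma sin_mean_value (R : realType) (y : R) : 0 < y ->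
  exists2 x, 0 < x < y & sin y = y * cos x.
Proof.
move=> y0; have [|x xy] := @MVT R sin cos 0 y y0 (fun x _ => is_derive_sin x).
  by apply: continuous_subspaceT => x; exact: continuous_sin.
rewrite sin0 !subr0 => ->; rewrite mulrC; exists x => //.
Qed.

Lemma norm_sin_le (R : realType) (y : R) : `|sin y| <= `|y|.
Proof.
wlog y0 : y / 0 < y => [h|].
  have [y0|y0|->] := ltrgtP y 0; [|exact: h|by rewrite sin0].
  by have := h (- y); rewrite sinN !normrN oppr_gt0; apply.
have [x _ ->] := sin_mean_value y0.
by rewrite normrM ler_piMr// cos_max.
Qed.

Lemma cos_lower_bound (R : realType) (y : R) : 1 - y ^+ 2 / 2 <= cos y.
Proof.
have -> : y = (y / 2) *+ 2 by rewrite -mulr_natr divfK.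
rewrite cos_mulr2n cos2sin2; set t := y / 2.
have : sin t ^+ 2 <= t ^+ 2.
  by rewrite -(real_normK (num_real (sin t))) -(real_normK (num_real t))
    lerXn2r// ?nnegrE// norm_sin_le.
by lra.
Qed.

Lemma norm_sin_sub_le (R : realType) (y : R) : `|sin y - y| <= `|y| ^+ 3 / 2.
Proof.
wlog y0 : y / 0 < y => [h|].
  have [y0|y0|->] := ltrgtP y 0; [|exact: h|].
  - have := h (- y); rewrite sinN oppr_gt0 normrN => /(_ y0).
    by rewrite -opprD normrN.
  - by rewrite sin0 subr0 normr0 expr0n/= mul0r.
have [x /andP[x0 xy] ->] := sin_mean_value y0.
have -> : y * cos x - y = - (y * (1 - cos x)) by ring.
rewrite normrN (gtr0_norm y0) ger0_norm; last first.
  by rewrite mulr_ge0 ?subr_ge0 ?cos_le1// ltW.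
rewrite exprS -mulrA ler_pM2l//.
have := cos_lower_bound x.
have : x ^+ 2 <= y ^+ 2 by rewrite lerXn2r// ?nnegrE ltW.
by lra.
Qed.

Lemma expR_second_order (R : realType) (x : R) :
  `|x| <= 1 / 2 -> 0 <= expR x - 1 - x <= 2 * x ^+ 2.
Proof.
rewrite ler_norml => /andP[x1 x2].
have h1 := expR_ge1Dx x; have h2 := expR_ge1Dx (- x).
have h3 := expRxMexpNx_1 x; have h4 := expR_gt0 x.
apply/andP; split; first lra.
have h5 : expR x * (1 - x) <= 1 by rewrite -[leRHS]h3 ler_wpM2l// ltW.
move: (expR x) h1 h4 h5 => E; clear -x1 x2 => h1 h4 h5.
suff : (E - 1 - x - 2 * x ^+ 2) * (1 - x) <= 0.
  by rewrite pmulr_lle0; lra.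
have : x ^+ 2 * x <= x ^+ 2 * (1 / 2) by rewrite ler_wpM2l ?sqr_ge0.
have := sqr_ge0 x; lra.
Qed.

Lemma cexpE (R : realType) (z : R[i]) : cexp z =
  (expR (complex.Re z) * cos (complex.Im z))
    +i* (expR (complex.Re z) * sin (complex.Im z)).
Proof.
by rewrite /cexp; apply/eqP; rewrite eq_complex/= !mul0r subr0 addr0 !eqxx.
Qed.

Lemma cexp0 (R : realType) : cexp (0 : R[i]) = 1.
Proof. by rewrite cexpE/= expR0 cos0 sin0 mulr1 mulr0. Qed.

Lemma cexpD (R : realType) (z w : R[i]) : cexp (z + w) = cexp z * cexp w.
Proof.
rewrite !cexpE !raddfD/= expRD cosD sinD.
by apply/eqP; rewrite eq_complex/=; apply/andP; split; apply/eqP; ring.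
Qed.

Lemma cexp_natmul (R : realType) (z : R[i]) k : cexp (z *+ k) = cexp z ^+ k.
Proof. by elim: k => [|k IH]; rewrite ?mulr0n ?cexp0// mulrS exprS cexpD IH. Qed.

Lemma cmod_cexp (R : realType) (z : R[i]) :
  cmod (cexp z) = expR (complex.Re z).
Proof.
rewrite /cexp cmodM cmodR ger0_norm ?expR_ge0//.
by rewrite /cmod/= cos2Dsin2 sqrtr1 mulr1.
Qed.

(** The remainder is controlled through the real and imaginary parts; the
constant 8 is convenient, not sharp. *)
Lemma cexp_second_order (R : realType) (u : R[i]) : cmod u <= 1 / 2 ->
  cmod (cexp u - 1 - u) <= 8 * cmod u ^+ 2.
Proof.
move=> u1.
have hu : cmod u ^+ 2 = complex.Re u ^+ 2 + complex.Im u ^+ 2.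
  by rewrite sqr_sqrtr// addr_ge0// sqr_ge0.
have /le_trans/(_ u1) x1 := le_Re_cmod u.
have /le_trans/(_ u1) y1 := le_Im_cmod u.
apply: le_trans (cmod_le_ReIm _) _.
rewrite hu cexpE; move: x1 y1; clear; case: u => x y /=.
rewrite oppr0 addr0 => x1 y1.
have /andP[e1 e2] := expR_second_order x1.
have c1 := cos_lower_bound y; have c2 := cos_le1 y.
have s1 := norm_sin_sub_le y.
move: x1 y1; rewrite !ler_norml => /andP[x1 x2] /andP[y1 y2].
have xx : x ^+ 2 <= 1 / 4 by nra.
have yy : `|y| ^+ 3 / 2 <= y ^+ 2 / 4.
  rewrite exprS real_normK ?num_real//.
  have : `|y| <= 1 / 2 by rewrite ler_norml y1.
  by have := sqr_ge0 y; nra.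
have {}s1 := le_trans s1 yy.
have e3 : expR x <= 2 by lra.
have -> : expR x * cos y - 1 - x
    = (expR x - 1 - x) - expR x * (1 - cos y) by ring.
have -> : expR x * sin y - y =
  expR x * (sin y - y) + (expR x - 1 - x) * y + x * y by ring.
have b1 : `|(expR x - 1 - x) - expR x * (1 - cos y)| <= 2 * x ^+ 2 + y ^+ 2.
  apply: le_trans (ler_normB _ _) _; rewrite ger0_norm//.
  rewrite ger0_norm ?mulr_ge0 ?expR_ge0 ?subr_ge0//.
  apply: lerD => //.
  have : expR x * (1 - cos y) <= 2 * (1 - cos y) by rewrite ler_wpM2r// subr_ge0.
  by lra.
have b2 : `|expR x * (sin y - y)| <= y ^+ 2 / 2.
  rewrite normrM ger0_norm ?expR_ge0//.
  have : expR x * `|sin y - y| <= 2 * (y ^+ 2 / 4) by rewrite ler_pM ?expR_ge0.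
  by lra.
have b3 : `|(expR x - 1 - x) * y| <= x ^+ 2.
  rewrite normrM ger0_norm//.
  have : (expR x - 1 - x) * `|y| <= (2 * x ^+ 2) * (1 / 2).
    by rewrite ler_pM// ler_norml y1.
  by lra.
have b4 : `|x * y| <= x ^+ 2 + y ^+ 2.
  by rewrite ler_norml; apply/andP; split; nra.
have := ler_normD (expR x * (sin y - y) + (expR x - 1 - x) * y) (x * y).
have := ler_normD (expR x * (sin y - y)) ((expR x - 1 - x) * y).
have := sqr_ge0 x; have := sqr_ge0 y; lra.
Qed.

Lemma cmod_subX_le (R : realType) (z w : R[i]) (m : R) k :
  cmod z <= m -> cmod w <= m ->
  cmod (z ^+ k.+1 - w ^+ k.+1) <= k.+1%:R * cmod (z - w) * m ^+ k.
Proof.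
move=> zm wm; have m0 : 0 <= m := le_trans (cmod_ge0 z) zm.
elim: k => [|k IH]; first by rewrite !expr1 expr0 mul1r mulr1.
have -> : z ^+ k.+2 - w ^+ k.+2
    = z * (z ^+ k.+1 - w ^+ k.+1) + (z - w) * w ^+ k.+1.
  by rewrite exprS [in w ^+ k.+2]exprS; ring.
apply: le_trans (cmod_le_add _ _) _; rewrite !cmodM cmodX.
have -> : k.+2%:R * cmod (z - w) * m ^+ k.+1
    = m * (k.+1%:R * cmod (z - w) * m ^+ k) + cmod (z - w) * m ^+ k.+1.
  by rewrite exprS -[k.+2%:R]natr1; ring.
apply: lerD; first by rewrite ler_pM ?cmod_ge0.
by rewrite ler_wpM2l ?cmod_ge0// lerXn2r// nnegrE ?cmod_ge0.
Qed.

(** e^(a z) = (e^u)^N with u = a z / N, where e^u and 1 + u differ by O(1/N^2);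
taking N-th powers of numbers of modulus at most e^(B/N) multiplies this error
by at most N e^B. The polynomials (1 + a X / N)^N thus converge uniformly. *)
Lemma poly_approx_cexp (R : realType) (a : R[i]) :
  poly_approx (fun z => cexp (a * z)).
Proof.
move=> M e e0; pose B := cmod a * `|M|.
have B0 : 0 <= B by rewrite mulr_ge0 ?cmod_ge0.
(* The final error is 8 B^2 e^B / N, and N >= 2 B makes |u| <= 1/2. *)
pose D := 8 * B ^+ 2 * expR B / e.
have D0 : 0 <= D.
  apply: divr_ge0; last exact: ltW.
  by apply: mulr_ge0; [apply: mulr_ge0 => //; exact: sqr_ge0|exact: expR_ge0].
pose k := Num.bound (2 * B + D).
have kP : 2 * B + D < k.+1%:R.
  apply: (@lt_trans _ _ k%:R); last by rewrite ltr_nat.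
  by apply: archi_boundP; rewrite addr_ge0// mulr_ge0.
set N : R := k.+1%:R in kP.
have N0 : 0 < N by rewrite ltr0n.
have NC : (k.+1%:R : R[i]) = N%:C by rewrite rmorph_nat.
exists ((1 + (a / k.+1%:R) *: 'X) ^+ k.+1) => z zM.
pose u := a * z / k.+1%:R.
have azu : a * z = u *+ k.+1.
  by rewrite /u -[RHS]mulr_natr divfK// NC; rewrite fmorph_eq0 gt_eqF.
have uB : cmod u <= B / N.
  rewrite /u NC cmodM cmodV cmodR (gtr0_norm N0) ler_pM2r ?invr_gt0//.
  rewrite cmodM ler_wpM2l ?cmod_ge0//; exact: le_trans (ler_norm _).
have -> : ((1 + (a / k.+1%:R) *: 'X) ^+ k.+1).[z] = (1 + u) ^+ k.+1.
  by rewrite horner_exp hornerD hornerC hornerZ hornerX /u mulrAC.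
rewrite azu cexp_natmul.
have hm : cmod (cexp u) <= expR (B / N).
  rewrite cmod_cexp ler_expR; apply: le_trans uB; apply: le_trans (le_Re_cmod u).
  exact: ler_norm.
have hm' : cmod (1 + u) <= expR (B / N).
  apply: le_trans (expR_ge1Dx _); apply: le_trans (cmod_le_add _ _) _.
  by rewrite cmod1 lerD2l.
apply: le_trans (cmod_subX_le _ hm hm') _; rewrite -/N.
have u2 : cmod u <= 1 / 2.
  apply: le_trans uB _; rewrite ler_pdivrMr//; lra.
have h2 : cmod (cexp u - (1 + u)) <= 8 * (B / N) ^+ 2.
  rewrite opprD addrA; apply: le_trans (cexp_second_order u2) _.
  by rewrite ler_wpM2l// lerXn2r// nnegrE ?cmod_ge0// divr_ge0// ltW.
have h3 : expR (B / N) ^+ k <= expR B.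
  rewrite -expRM_natr ler_expR mulrAC ler_pdivrMr//.
  by rewrite ler_wpM2l// ler_nat.
have : N * cmod (cexp u - (1 + u)) * expR (B / N) ^+ k
    <= N * (8 * (B / N) ^+ 2) * expR B.
  rewrite ler_pM ?mulr_ge0 ?cmod_ge0 ?exprn_ge0 ?expR_ge0 ?(ltW N0)//.
  by rewrite ler_pM2l.
move=> /le_trans; apply.
have -> : N * (8 * (B / N) ^+ 2) * expR B = 8 * B ^+ 2 * expR B / N.
  by field; rewrite gt_eqF.
rewrite ler_pdivrMr//.
have : D <= N by lra.
by rewrite /D ler_pdivrMr// [e * _]mulrC.
Qed.

(** * Closure properties of uniform limits of polynomials *)

Lemma poly_approx_horner (R : realType) (p : {poly R[i]}) :
  poly_approx (horner p).
Proof. by move=> M e e0; exists p => z _; rewrite subrr cmod0 ltW. Qed.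

Lemma poly_approxD (R : realType) (f g : R[i] -> R[i]) :
  poly_approx f -> poly_approx g -> poly_approx (fun z => f z + g z).
Proof.
move=> hf hg M e e0; have e20 : 0 < e / 2 by rewrite divr_gt0.
have [p hp] := hf M _ e20; have [s hs] := hg M _ e20.
exists (p + s) => z zM; rewrite hornerD opprD addrACA [e]splitr.
apply: le_trans (cmod_le_add _ _) _; apply: lerD; [exact: hp|exact: hs].
Qed.

Lemma poly_approxZ (R : realType) (c : R[i]) (f : R[i] -> R[i]) :
  poly_approx f -> poly_approx (fun z => c * f z).
Proof.
move=> hf M e e0; have c1 : 0 < cmod c + 1 by rewrite ltr_wpDl// cmod_ge0.
have [p hp] := hf M (e / (cmod c + 1)) (divr_gt0 e0 c1).
exists (c *: p) => z zM; rewrite hornerZ -mulrBr cmodM.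
apply: (@le_trans _ _ (cmod c * (e / (cmod c + 1)))).
  by rewrite ler_wpM2l ?cmod_ge0// hp.
rewrite mulrA ler_pdivrMr// mulrDr mulr1 [e * _]mulrC lerDl; exact: ltW.
Qed.

Lemma poly_approx_sum (R : realType) (I : finType) (f : I -> R[i] -> R[i]) :
  (forall i, poly_approx (f i)) -> poly_approx (fun z => \sum_i f i z).
Proof.
move=> hf; rewrite /index_enum; elim: (Finite.enum _) => [|i s IH].
  move=> M e e0; exists 0 => z _; rewrite big_nil horner0 subrr cmod0; exact: ltW.
have := poly_approxD (hf i) IH.
by under [X in _ -> poly_approx X]eq_fun do rewrite big_cons.
Qed.

(** Requiring M >= 1 lets one power of M bound all partial products. *)
Lemma prod_lipschitz (R : realType) (I : Type) (s : seq I) (x y : I -> R[i])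
    (M e : R) :
  1 <= M -> 0 <= e -> (forall i, cmod (x i) <= M) ->
  (forall i, cmod (y i) <= M) -> (forall i, cmod (x i - y i) <= e) ->
  cmod (\prod_(i <- s) x i - \prod_(i <- s) y i)
    <= (size s)%:R * M ^+ size s * e.
Proof.
move=> M1 e0 xM yM xye; have M0 : 0 <= M := le_trans ler01 M1.
elim: s => [|i s IH]; first by rewrite !big_nil subrr cmod0 !mul0r.
rewrite !big_cons; set a := \prod_(j <- s) x j in IH *.
set b := \prod_(j <- s) y j in IH *.
have aM : cmod a <= M ^+ size s.
  rewrite /a; elim: (s) => [|j t IHt]; first by rewrite big_nil cmod1.
  by rewrite big_cons cmodM exprS ler_pM ?cmod_ge0.
have -> : x i * a - y i * b = (x i - y i) * a + y i * (a - b) by ring.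
apply: le_trans (cmod_le_add _ _) _; rewrite !cmodM /=.
have -> : (size s).+1%:R * M ^+ (size s).+1 * e
  = e * M ^+ (size s).+1 + M * ((size s)%:R * M ^+ size s * e).
  by rewrite -natr1 exprS; ring.
apply: lerD; last by rewrite ler_pM ?cmod_ge0.
rewrite ler_pM ?cmod_ge0// (le_trans aM)// exprS ler_peMl// exprn_ge0//.
Qed.

Lemma det_lipschitz (R : realType) (N : nat) (M : R) :
  exists2 L : R, 0 <= L & forall (X Y : 'M[R[i]]_N) (e : R), 0 <= e ->
    (forall i j, cmod (X i j) <= M) -> (forall i j, cmod (Y i j) <= M) ->
    (forall i j, cmod (X i j - Y i j) <= e) ->
    cmod (\det X - \det Y) <= L * e.
Proof.
pose B := Num.max 1 M; have B1 : 1 <= B by rewrite le_max lexx.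
have MB : M <= B by rewrite le_max lexx orbT.
pose P := N%:R * B ^+ N.
exists (\sum_(s : {perm 'I_N}) P).
  by rewrite sumr_ge0// => s _; rewrite mulr_ge0// exprn_ge0// (le_trans ler01).
move=> X Y e e0 hX hY hXY; rewrite /determinant -sumrB.
apply: le_trans (cmod_sum _ _) _; rewrite mulr_suml; apply: ler_sum => s _.
rewrite -mulrBr cmodM cmodX cmodN cmod1 expr1n mul1r.
have := @prod_lipschitz R 'I_N (index_enum 'I_N) (fun i => X i (s i))
  (fun i => Y i (s i)) B e B1 e0.
rewrite /P -[size _]/(size (index_enum 'I_N)).
have -> : size (index_enum 'I_N) = N.
  by rewrite -[RHS](card_ord N) cardE enumT.
by apply => i //; exact: le_trans MB.
Qed.

Lemma poly_approx_entries_bounded (R : realType) (N : nat)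
    (A : R[i] -> 'M[R[i]]_N) (M : R) :
  (forall i j, poly_approx (fun z => A z i j)) ->
  exists2 B : R, 0 <= B &
    forall z i j, cmod z <= M -> cmod (A z i j) <= B.
Proof.
move=> hA.
have [b hb] : {b : 'I_N * 'I_N -> R & forall ij, 0 <= b ij /\
    forall z, cmod z <= M -> cmod (A z ij.1 ij.2) <= b ij}.
  apply: (@boolp.choice _ _ (fun ij c => 0 <= c /\
    forall z, cmod z <= M -> cmod (A z ij.1 ij.2) <= c)) => -[i j].
  by have [L L0 hL] := poly_approx_bounded M (hA i j); exists L.
exists (\sum_ij b ij) => [|z i j /((hb (i, j)).2 z)/= /le_trans]; last apply.
  by rewrite sumr_ge0// => ij _; exact: (hb ij).1.
by rewrite (bigD1 (i, j))//= lerDl sumr_ge0// => ij _; exact: (hb ij).1.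
Qed.

(** The determinant of a matrix of polynomial approximants is a polynomial, and
det_lipschitz bounds its distance to the determinant. *)
Lemma poly_approx_det (R : realType) (N : nat) (A : R[i] -> 'M[R[i]]_N) :
  (forall i j, poly_approx (fun z => A z i j)) ->
  poly_approx (fun z => \det (A z)).
Proof.
move=> hA M e e0.
have [B B0 AB] := poly_approx_entries_bounded M hA.
have [L L0 hL] := @det_lipschitz R N (B + 1).
pose d := Num.min 1 (e / (L + 1)).
have L1 : 0 < L + 1 by rewrite ltr_wpDl.
have d0 : 0 < d by rewrite lt_min ltr01 divr_gt0.
have [p hp] : {p : 'I_N * 'I_N -> {poly R[i]} & forall ij,
    forall z, cmod z <= M -> cmod (A z ij.1 ij.2 - (p ij).[z]) <= d}.
  apply: (@boolp.choice _ _ (fun ij p =>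
    forall z, cmod z <= M -> cmod (A z ij.1 ij.2 - p.[z]) <= d)) => -[i j].
  exact: hA.
exists (\det (\matrix_(i, j) p (i, j))) => z zM.
rewrite -[_.[z]]/(horner_eval z _) -det_map_mx.
have h1 i j : cmod (A z i j - (p (i, j)).[z]) <= d by exact: (hp (i, j)).
have d1 : d <= 1 by rewrite ge_min lexx.
apply: (@le_trans _ _ (L * d)); last first.
  apply: (@le_trans _ _ (L * (e / (L + 1)))).
    by rewrite ler_wpM2l// ge_min lexx orbT.
  by rewrite mulrA ler_pdivrMr// mulrDr mulr1 [e * _]mulrC lerDl ltW.
apply: hL => [|i j|i j|i j]; rewrite ?mxE/= ?horner_evalE; first exact: ltW.
- by apply: le_trans (AB _ _ _ zM) _; rewrite lerDl.
- have := cmod_sub_le (p (i, j)).[z] (A z i j); rewrite cmod_distC.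
  by have := h1 i j; have := AB _ i j zM; lra.
- exact: h1.
Qed.

(** * Roots of z = mu (1 - exp (- z)) in the right half-plane *)

(** Composing acos with clip extends it continuously to the whole line, so that
the angle along the level curve is defined and continuous everywhere. *)
Definition clip (R : realType) (x : R) : R := Num.max (-1) (Num.min 1 x).

Lemma clip_itv (R : realType) (x : R) : -1 <= clip x <= 1.
Proof.
by rewrite le_max lexx/= ge_max ge_min lexx/= (le_trans (lerN10 _) ler01).
Qed.

Lemma clip_id (R : realType) (x : R) : -1 <= x <= 1 -> clip x = x.
Proof. by move=> /andP[x1 x2]; rewrite /clip (min_idPr x2) (max_idPr x1). Qed.

Lemma clip_continuous (R : realType) : continuous (@clip R).
Proof.
move=> x; apply: (@continuous_max R R (fun=> -1) (fun y => Num.min 1 y)).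
  exact: cvg_cst.
by apply: (@continuous_min R R (fun=> 1) id); [exact: cvg_cst|exact: cvg_id].
Qed.

(** acos is the inverse of a monotone continuous function on a segment, hence
continuous up to the end points -1 and 1, which clip reaches. *)
Lemma acos_clip_continuous (R : realType) :
  continuous (fun x : R => acos (clip x)).
Proof.
have pi0 := pi_ge0 R.
have : {within `[cos (pi : R), cos 0], continuous (@acos R)}.
  apply: (@segment_can_ge_continuous R 0 pi cos) => //.
  - by apply: continuous_subspaceT => x; exact: continuous_cos.
  - exact: cosK.
rewrite cospi cos0 => /subspace_continuousP h x.
have /h : [set` `[(-1 : R), 1]] (clip x) by rewrite /= in_itv/= clip_itv.
apply: cvg_comp => P hP.
have : nbhs x (@clip R @^-1` [set y | [set` `[(-1 : R), 1]] y -> P y]).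
  exact: clip_continuous.
by apply: filterS => y /=; apply; rewrite in_itv/= clip_itv.
Qed.

Lemma polar_mul_cexp (R : realType) (r t x y : R) :
  ((r * cos t) +i* (r * sin t)) * cexp (x +i* y)
    = (r * expR x * cos (t + y)) +i* (r * expR x * sin (t + y)).
Proof.
rewrite cexpE/= cosD sinD.
by apply/eqP; rewrite eq_complex/=; apply/andP; split; apply/eqP; ring.
Qed.

Lemma polar_of_acos (R : realType) (a b : R) : 0 < b ->
  let s := Num.sqrt (a ^+ 2 + b ^+ 2) in
  [/\ 0 < s, -1 <= a / s <= 1, s * cos (acos (a / s)) = a
    & s * sin (acos (a / s)) = b].
Proof.
move=> b0 s.
have s2 : s ^+ 2 = a ^+ 2 + b ^+ 2 by rewrite sqr_sqrtr// addr_ge0// sqr_ge0.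
have s0 : 0 < s by rewrite sqrtr_gt0 ltr_wpDl ?sqr_ge0// exprn_gt0.
have as1 : -1 <= a / s <= 1.
  have : `|a| <= s by rewrite -sqrtr_sqr ler_wsqrtr// lerDl sqr_ge0.
  rewrite ler_norml => /andP[a1 a2].
  by rewrite ler_pdivlMr// ler_pdivrMr// mulN1r mul1r a1.
split => //.
  by rewrite acosK// mulrC divfK// gt_eqF.
rewrite sin_acos// -[X in X * _](gtr0_norm s0) -sqrtr_sqr -sqrtrM ?sqr_ge0//.
rewrite mulrBr mulr1 expr_div_n mulrC divfK ?expf_neq0 ?gt_eqF//.
by rewrite s2 addrAC subrr add0r sqrtr_sqr gtr0_norm.
Qed.

(** For v = a + i b with b > 0 this is arg v + Im v, an argument of v e^v which is
not reduced modulo 2 pi. *)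
Definition lambert_angle (R : realType) (a b : R) : R :=
  acos (a / Num.sqrt (a ^+ 2 + b ^+ 2)) + b.

(** Along |w| e^x = rho, where rho = |v| e^a and x = Re w, the cosine of arg w is
c(x) = x e^x / rho, and in the upper half-plane the angle arg w + Im w is the
function Phi below. It vanishes at a point x0 to the right of a and exceeds pi at
a, so it takes every value of [0, pi] strictly to the right of a. *)
Lemma lambert_root_right (R : realType) (a b : R) : 0 < b ->
  pi < lambert_angle a b ->
  exists2 w : R[i], a < complex.Re w & w * cexp w = (a +i* b) * cexp (a +i* b).
Proof.
rewrite /lambert_angle => b0; have [] := polar_of_acos a b0.
set s := Num.sqrt _; set th := acos (a / s) => s0 as1 sa sb thb.
have N11 : (-1 : R) <= 1 by lra.
pose rho := s * expR a.
have rho0 : 0 < rho by rewrite mulr_gt0// expR_gt0.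
pose c (x : R) := x * expR x / rho.
have cc : continuous c.
  move=> x; apply: cvgMl; apply: cvgM; [exact: cvg_id|exact: continuous_expR].
have ca : c a = a / s.
  by rewrite /c /rho -mulf_div divff ?mulr1// gt_eqF// expR_gt0.
pose Phi x :=
  acos (clip (c x)) + rho * expR (- x) * Num.sqrt (1 - clip (c x) ^+ 2).
have cPhi : continuous Phi.
  have c1 : continuous (@clip R \o c).
    by move=> x; apply: continuous_comp; [exact: cc|exact: clip_continuous].
  move=> x; apply: cvgD.
    apply: (@continuous_comp _ _ _ c (fun y => acos (clip y))); first exact: cc.
    exact: acos_clip_continuous.
  apply: cvgM.
    apply: cvgM; first exact: cvg_cst.
    apply: (@continuous_comp _ _ _ (fun y => - y) expR).
      by apply: cvgN; exact: cvg_id.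
    exact: continuous_expR.
  apply: (@continuous_comp _ _ _ (fun y => 1 - clip (c y) ^+ 2) Num.sqrt).
    apply: cvgB; first exact: cvg_cst.
    apply: (@continuous_comp _ _ _ (@clip R \o c) (fun y => y ^+ 2)).
      exact: c1.
    exact: exprn_continuous.
  exact: sqrt_continuous.
have Phia : Phi a = th + b.
  rewrite /Phi ca clip_id// -sin_acos// /rho -[s * _ * _]mulrA -expRD subrr expR0.
  by rewrite mulr1 sb.
have Phi1 x : c x = 1 -> Phi x = 0.
  move=> cx; rewrite /Phi cx clip_id ?lexx ?N11// acos1 expr1n subrr sqrtr0.
  by rewrite mulr0 addr0.
have PhiN1 x : clip (c x) = -1 -> Phi x = pi.
  by move=> cx; rewrite /Phi cx acosN1 sqrrN expr1n subrr sqrtr0 mulr0 addr0.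
have [x0 ax0 cx0] : exists2 x0, a <= x0 & c x0 = 1.
  pose X := rho + `|a|.
  have aX : a <= X by rewrite ler_wpDl ?(ltW rho0)// ler_norm.
  have cX : 1 <= c X.
    rewrite /c ler_pdivlMr// mul1r.
    have : 1 <= expR X by rewrite -(expR0 R) ler_expR addr_ge0// ltW.
    have : rho <= X by rewrite lerDl.
    have := ltW rho0; clear; nra.
  have [|x] := @IVT R c a X 1 aX (continuous_subspaceT cc).
    by rewrite ge_min le_max ca (andP as1).2 cX orbT.
  by rewrite in_itv/= => /andP[ax _] cx; exists x.
have pi0 := pi_gt0 R.
pose t : R := acos (cos (th + b)).
have cosi : -1 <= cos (th + b) <= 1 by rewrite cos_geN1 cos_le1.
have t0 : 0 <= t by exact: acos_ge0.
have tpi : t <= pi by exact: acos_lepi.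
(* Where |c x| > 1 the abscissa x is not on the level curve and Phi is constant,
   equal to 0 or pi; this value is also attained at a point with |c x| = 1. *)
have [x [ax cx Phix]] : exists x, [/\ a < x, -1 <= c x <= 1 & Phi x = t].
  have neq_a x : a <= x -> Phi x <= pi -> a < x.
    rewrite le_eqVlt => /orP[/eqP <-|//].
    by rewrite Phia leNgt thb.
  have [|x] := @IVT R Phi a x0 t ax0 (continuous_subspaceT cPhi).
    by rewrite ge_min le_max (Phi1 x0)// Phia t0 (ltW (le_lt_trans tpi thb)) orbT.
  rewrite in_itv/= => /andP[ax xx0] Phix.
  have [c1|c1] := leP (c x) 1; last first.
    have Px : clip (c x) = 1.
      by rewrite /clip (min_idPl (ltW c1)) (max_idPr N11).
    have t00 : t = 0.
      by rewrite -Phix /Phi Px acos1 expr1n subrr sqrtr0 mulr0 addr0.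
    exists x0; rewrite cx0 lexx N11 Phi1//; split => //.
    by apply: neq_a => //; rewrite Phi1// ltW.
  have [cN1|cN1] := leP (-1) (c x).
    by exists x; split; rewrite ?c1 ?cN1//; apply: neq_a; rewrite ?Phix.
  have tP : t = pi.
    rewrite -Phix PhiN1// /clip (min_idPr c1); exact/max_idPl/ltW.
  have [|x1] := @IVT R c x x0 (-1) xx0 (continuous_subspaceT cc).
    by rewrite ge_min le_max cx0 N11 (ltW cN1) orbT.
  rewrite in_itv/= => /andP[xx1 _] cx1.
  have Px1 : Phi x1 = pi by rewrite PhiN1// cx1 clip_id// lexx N11.
  exists x1; rewrite cx1 lexx N11 tP; split => //.
  by apply: neq_a; rewrite ?Px1// (le_trans ax).
pose al := acos (c x); pose r := rho * expR (- x).
pose y := r * sin al.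
have xE : x = r * cos al.
  rewrite /r /al acosK// /c.
  have -> : rho * expR (- x) * (x * expR x / rho) = x * (expR x * expR (- x)).
    by field; rewrite gt_eqF.
  by rewrite expRxMexpNx_1 mulr1.
have aly : al + y = t.
  by rewrite -Phix /Phi clip_id// -sin_acos.
have rx : r * expR x = rho by rewrite /r -mulrA -expRD addNr expR0 mulr1.
have vE : (a +i* b) * cexp (a +i* b)
    = (rho * cos (th + b)) +i* (rho * sin (th + b)).
  by rewrite -[in X in X * _]sa -[in X in X * _]sb polar_mul_cexp.
have cost : cos t = cos (th + b) by rewrite /t acosK.
have sint : sin t = `|sin (th + b)|.
  by rewrite /t sin_acos// -sin2cos2 sqrtr_sqr.
(* t lies in [0, pi] and has the cosine of th + b; the sign of the sine decides
   between w and its conjugate. *)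
have [s_ge0|s_lt0] := leP 0 (sin (th + b)).
  exists (x +i* y) => //.
  rewrite {1}xE {1}/y polar_mul_cexp rx aly cost sint vE.
  by rewrite ger0_norm.
exists (x +i* - y) => //.
have -> : x +i* - y = (r * cos (- al)) +i* (r * sin (- al)).
  by rewrite cosN sinN -xE mulrN.
have -> : cexp ((r * cos (- al)) +i* (r * sin (- al))) = cexp (x +i* - y).
  by rewrite cosN sinN -xE mulrN.
rewrite polar_mul_cexp rx -opprD aly cosN sinN cost sint vE.
by rewrite ltr0_norm// opprK.
Qed.

(** The function mu (1 - e^-z) - z has slope mu - 1 > 0 at 0 and is negative at
z = mu. *)
Lemma real_root_right (R : realType) (mu : R) : 1 < mu ->
  exists2 z : R, 0 < z & z = mu * (1 - expR (- z)).
Proof.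
move=> mu1; pose f (z : R) := mu * (1 - expR (- z)) - z.
have cf : continuous f.
  move=> z; apply: cvgB; last exact: cvg_id.
  apply: cvgM; first exact: cvg_cst.
  apply: cvgB; first exact: cvg_cst.
  apply: (@continuous_comp _ _ _ (fun y => - y) expR).
    by apply: cvgN; exact: cvg_id.
  exact: continuous_expR.
pose d := (mu - 1) / 2.
have d0 : 0 < d by rewrite divr_gt0// subr_gt0.
have dmu : d <= mu by rewrite /d; lra.
have fd : 0 <= f d.
  rewrite /f; have h1 := expR_ge1Dx d; have h2 := expRxMexpNx_1 d.
  have h3 := expR_gt0 (- d).
  have : (1 + d) * expR (- d) <= 1 by rewrite -[leRHS]h2 ler_wpM2r// ltW.
  have -> : mu = 1 + 2 * d by rewrite /d; field.
  move: (expR (- d)) h3 => E E0; clear -d0 E0 => h.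
  have : d * ((1 + d) * E) <= d * 1 by rewrite ler_wpM2l// ltW.
  nra.
have fmu : f mu <= 0.
  rewrite /f; have := expR_gt0 (- mu); move: (expR _) => E E0; clear -mu1 E0; nra.
have [|z] := @IVT R f d mu 0 dmu (continuous_subspaceT cf).
  by rewrite ge_min le_max fd fmu orbT.
rewrite in_itv/= => /andP[dz _] fz; exists z; first exact: lt_le_trans dz.
by apply/eqP; rewrite eq_sym -subr_eq0; apply/eqP.
Qed.

(** Moving slightly to the left makes a non-strict bound on the real part
strict. *)
Lemma closure_setS (R : realType) (mu : R[i]) :
  - pi < complex.Im mu -> complex.Im mu < pi ->
  complex.Re mu <= (if complex.Im mu == 0 then 1
                    else complex.Im mu * cot (complex.Im mu)) ->
  closure (@setS R) mu.
Proof.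
move=> i1 i2 hre B /nbhs_ballP[e /= e0 eB].
pose d := complex.Re e.
have [d0 eE] : 0 < d /\ e = d%:C.
  move: e0; rewrite /d; case: (e) => x y; rewrite ltcE/=.
  by move=> /andP[/eqP -> x0].
exists (mu - (d / 2)%:C); split.
  rewrite /setS/= !raddfB/= subr0; split => //.
  by apply: lt_le_trans hre; rewrite ltrBlDr ltrDl divr_gt0.
apply: eB; rewrite eE /ball/= opprB addrC subrK normcC_cmod cmodR.
rewrite gtr0_norm ?divr_gt0// ltcR; lra.
Qed.

(** If the angle th + b were at most pi, then sin (th + b) >= 0; multiplied by
|v| this is a sin b + b cos b >= 0, that is Re mu <= b cot b. *)
Lemma notin_closure_setS (R : realType) (mu : R[i]) :
  complex.Im mu != 0 -> ~ closure (@setS R) mu ->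
  pi < lambert_angle (- complex.Re mu) `|complex.Im mu|.
Proof.
move=> im0 hmu; set a := - complex.Re mu; set b := `|complex.Im mu|.
rewrite /lambert_angle ltNge; apply/negP => hle; apply: hmu.
have b0 : 0 < b by rewrite normr_gt0.
have [] := polar_of_acos a b0.
move: hle; set s := Num.sqrt _; set th := acos (a / s) => hle s0 as1 sa sb.
have th0 : 0 < th.
  rewrite lt_def acos_ge0// andbT; apply/eqP => th0.
  by move: sb; rewrite th0 sin0 mulr0 => /esym b00; rewrite b00 ltxx in b0.
have : b < pi by lra.
rewrite ltr_norml => /andP[i1 i2].
have bpi : b < pi by lra.
apply: closure_setS => //; rewrite (negbTE im0).
have -> : complex.Im mu * cot (complex.Im mu) = b * cos b / sin b.
  rewrite /cot mulrA /b; have [im1|im1|im1] := ltrgtP (complex.Im mu) 0.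
  - by rewrite ltr0_norm// sinN cosN invrN mulrN mulNr !mulNr opprK.
  - by rewrite gtr0_norm.
  - by rewrite im1 eqxx in im0.
have sinb : 0 < sin b by rewrite sin_gt0_pi// b0.
have sab : 0 <= s * sin (th + b).
  by rewrite mulr_ge0 ?(ltW s0)// sin_ge0_pi// hle andbT addr_ge0// ltW.
have -> : complex.Re mu = - a by rewrite opprK.
rewrite ler_pdivlMr//.
move: sab; rewrite sinD mulrDr !mulrA sa sb; lra.
Qed.

Lemma cexp_conj (R : realType) (z : R[i]) : cexp z^*%C = (cexp z)^*%C.
Proof. by case: z => x y; rewrite !cexpE/= cosN sinN mulrN. Qed.

Lemma conjc_root (R : realType) (mu z : R[i]) :
  z = mu * (1 - cexp (- z)) -> z^*%C = mu^*%C * (1 - cexp (- z^*%C)).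
Proof.
move=> zE; rewrite -[- z^*%C]rmorphN cexp_conj {1}zE rmorphM rmorphB rmorph1.
by [].
Qed.

(** For Im mu < 0 the number v = - mu lies in the upper half-plane, and z = w + mu
for the w of lambert_root_right; the case Im mu > 0 follows by conjugation. *)
Lemma delay_root_right (R : realType) (mu : R[i]) :
  ~ closure (@setS R) mu ->
  exists2 z : R[i], 0 < complex.Re z & z = mu * (1 - cexp (- z)).
Proof.
have neg (nu : R[i]) : complex.Im nu < 0 -> 
    pi < lambert_angle (- complex.Re nu) (- complex.Im nu) ->
    exists2 z : R[i], 0 < complex.Re z & z = nu * (1 - cexp (- z)).
  move=> im0 /lambert_root_right[|w aw wE]; first by rewrite oppr_gt0.
  have vE : (- complex.Re nu) +i* (- complex.Im nu) = - nu by case: (nu).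
  rewrite vE in wE.
  exists (w + nu); first by rewrite raddfD/= -ltrBlDr sub0r.
  rewrite opprD cexpD mulrBr mulr1 addrC; congr (_ + _).
  have -> : nu * (cexp (- w) * cexp (- nu))
    = - ((- nu * cexp (- nu)) * cexp (- w)) by ring.
  by rewrite opprK -wE -mulrA -cexpD subrr cexp0 mulr1.
move=> hmu; have [im0|im0|im0] := ltrgtP (complex.Im mu) 0.
- apply: neg => //; rewrite -(ltr0_norm im0).
  by apply: notin_closure_setS => //; rewrite lt_eqF.
- have [||z z0 zE] := neg mu^*%C.
  + by case: (mu) im0 => x y /=; rewrite oppr_lt0.
  + have := notin_closure_setS _ hmu; rewrite (gt_eqF im0) => /(_ isT).
    by rewrite (gtr0_norm im0); case: (mu) => x y /=; rewrite opprK.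
  + exists z^*%C; first by case: (z) z0.
    by have := conjc_root zE; rewrite conjcK.
- have re1 : 1 < complex.Re mu.
    rewrite ltNge; apply/negP => re1; apply: hmu.
    by apply: closure_setS; rewrite im0 ?oppr_lt0 ?pi_gt0// eqxx.
  have [z z0 zE] := real_root_right re1.
  exists z%:C => //.
  have -> : mu = (complex.Re mu)%:C by case: (mu) im0 => x y /= ->.
  have -> : cexp (- z%:C) = (expR (- z))%:C.
    by rewrite cexpE/= oppr0 cos0 sin0 mulr1 mulr0.
  by rewrite {1}zE rmorphM/= rmorphB/= rmorph1.
Qed.

(** * Isolation of the roots of z = mu (1 - exp (- z)) *)

(** This is the isolation of the double zero of e^-h - 1 + h at 0, by a real
argument. With h = x + i y and y <> 0, taken positive, the imaginary part says
e^-x cos t = 1 for some t in (0, y), whence x < 0; but cos y < cos t turns the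
real part into 1 - x < 1. *)
Lemma cexp_eq_linear (R : realType) (h : R[i]) :
  cmod h <= 1 -> cexp (- h) = 1 - h -> h = 0.
Proof.
move=> /(le_trans (le_Im_cmod h)) y1.
rewrite cexpE; case: h y1 => x y /= y1 /eqP.
rewrite eq_complex/= cosN sinN mulrN => /andP[/eqP hre].
rewrite sub0r eqr_opp => /eqP him.
have [y0|y0] := eqVneq y 0.
  have [->|x0] := eqVneq x 0; first by rewrite y0.
  have := @expR_gt1Dx _ (- x); rewrite oppr_eq0 => /(_ x0).
  by move: hre; rewrite y0 cos0 mulr1 => ->; rewrite ltxx.
exfalso.
have {}him : `|y| = expR (- x) * sin `|y|.
  have [yge|ylt] := leP 0 y; first by rewrite ger0_norm.
  by rewrite ltr0_norm// sinN mulrN him.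
rewrite -(cos_norm y) in hre.
have := y1; move: y0 him hre; rewrite -normr_gt0; move: `|y| => {y1}y y0.
have [t /andP[t0 ty] ->] := sin_mean_value y0.
move=> him hre y1; have pi2 := pi_ge2 R.
have ct : cos y < cos t.
  by rewrite ltr_cos// in_itv/=; apply/andP; split; lra.
have ct1 : cos t < 1.
  by rewrite -cos0 ltr_cos// in_itv/=; apply/andP; split; lra.
have {}him : expR (- x) * cos t = 1.
  apply: (mulfI (lt0r_neq0 y0)); rewrite mulr1 [RHS]him; ring.
have e0 := expR_gt0 (- x).
have : expR (- x) * cos y < 1 by rewrite -him ltr_pM2l.
have : 1 < expR (- x) by rewrite -him gtr_pMr.
by rewrite hre expR_gt1; lra.
Qed.

(** Put h = z - z0 and a = mu e^-z0. The equation at z becomes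
(1 - a) h + a (e^-h - 1 + h) = 0, where the last bracket is O(h^2). If a <> 1 the
linear term dominates for small h; if a = 1, which happens for a double root,
cexp_eq_linear applies. *)
Lemma delay_root_isolated (R : realType) (mu z0 : R[i]) :
  z0 = mu * (1 - cexp (- z0)) ->
  exists2 d : R, 0 < d & forall z, cmod (z - z0) < d ->
    z = mu * (1 - cexp (- z)) -> z = z0.
Proof.
move=> z0E; pose a := mu * cexp (- z0).
have key z : z = mu * (1 - cexp (- z)) ->
    (1 - a) * (z - z0) + a * (cexp (- (z - z0)) - 1 - - (z - z0)) = 0.
  move=> zE.
  have -> : cexp (- (z - z0)) = cexp (- z) * cexp z0.
    by rewrite opprB addrC cexpD.
  have cc : cexp (- z0) * cexp z0 = 1 by rewrite -cexpD addNr cexp0.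
  have -> : (1 - a) * (z - z0) + a * (cexp (- z) * cexp z0 - 1 - - (z - z0))
    = z - z0 - a + mu * cexp (- z) * (cexp (- z0) * cexp z0) by rewrite /a; ring.
  rewrite cc [in X in X - _ - _]zE [in X in _ - X - _]z0E /a; ring.
have [a1|a1] := eqVneq a 1.
  exists 1 => // z zd /key; rewrite a1 subrr mul0r add0r mul1r opprK.
  move=> /eqP; rewrite addrAC subr_eq0 => hz.
  apply/eqP; rewrite -subr_eq0; apply/eqP/cexp_eq_linear; first exact: ltW.
  by rewrite -(eqP hz) addrK.
pose b := 8 * cmod a + 1.
have b0 : 0 < b by rewrite ltr_wpDl// mulr_ge0// cmod_ge0.
have a10 : 0 < cmod (1 - a) by rewrite cmod_gt0 subr_eq0 eq_sym.
exists (Num.min (1 / 2) (cmod (1 - a) / b)).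
  by rewrite lt_min !divr_gt0.
move=> z; rewrite lt_min (ltr_pdivlMr _ _ b0) => /andP[z1 z2] /key.
set h := z - z0 in z1 z2 *; move=> /eqP; rewrite addr_eq0 => /eqP hE.
apply/eqP; rewrite -subr_eq0 -/h -cmod_eq0 eq_le cmod_ge0 andbT leNgt.
apply/negP => h0.
have h12 : cmod (- h) <= 1 / 2 by rewrite cmodN ltW.
have := cexp_second_order h12; rewrite cmodN => hE2.
have : cmod (1 - a) * cmod h <= cmod a * (8 * cmod h ^+ 2).
  by rewrite -cmodM hE cmodN cmodM ler_wpM2l// cmod_ge0.
have -> : cmod a * (8 * cmod h ^+ 2) = 8 * cmod a * cmod h * cmod h by ring.
rewrite ler_pM2r// leNgt => /negP; apply.
by apply: lt_trans z2; rewrite mulrC ltr_pM2l// ltrDl.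
Qed.

(** * The limit determinant and its perturbation *)

Lemma poly_root_isolated (R : realType) (p : {poly R[i]}) (mu : R[i]) :
  p != 0 -> exists2 d : R, 0 < d &
    forall t, root p t -> cmod (t - mu) < d -> t = mu.
Proof.
move=> p0; have [s pE] := closed_field_poly_normal p.
have [d d0 hd] : exists2 d : R, 0 < d &
    forall t, t \in s -> cmod (t - mu) < d -> t = mu.
  elim: (s) => [|a u [d d0 hd]]; first by exists 1.
  have [->|amu] := eqVneq a mu.
    exists d => // t; rewrite inE => /orP[/eqP//|]; exact: hd.
  exists (Num.min d (cmod (a - mu))).
    by rewrite lt_min d0 cmod_gt0 subr_eq0.
  move=> t; rewrite inE lt_min => /orP[/eqP ->|tu] /andP[td ta]; last exact: hd.
  by rewrite ltxx in ta.
exists d => // t; rewrite pE rootZ ?lead_coef_eq0// root_prod_XsubC; exact: hd.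
Qed.

(** With I the identity and Mb = diag(M, 0), this is the limit at r = 0 of the
characteristic matrix of the finite-difference loop multiplied by r, in the
variable z = lambda r. *)
Definition limit_mx (R : realType) (N : nat) (I Mb : 'M[R[i]]_N) (z : R[i]) :
    'M[R[i]]_N :=
  z *: I - (1 - cexp (- z)) *: Mb.

(** The characteristic matrix multiplied by r is limit_mx - r rest_mx. *)
Definition rest_mx (R : realType) (N K : nat) (L : 'M[R[i]]_N)
    (A : 'I_K -> 'M[R[i]]_N) (tau : 'I_K -> R) (r : R) (z : R[i]) :
    'M[R[i]]_N :=
  L + \sum_(k < K) cexp (- (z / r%:C) * (tau k)%:C) *: A k.

Lemma poly_approx_limit_mx (R : realType) (N : nat) (I Mb : 'M[R[i]]_N) i j :
  poly_approx (fun z => limit_mx I Mb z i j).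
Proof.
pose p : {poly R[i]} := I i j *: 'X + (- Mb i j)%:P.
have -> : (fun z => limit_mx I Mb z i j) =
    (fun z => p.[z] + Mb i j * cexp ((- 1) * z)).
  apply/funext => z; rewrite !mxE hornerD hornerZ hornerX hornerC mulN1r.
  by ring.
apply: poly_approxD; first exact: poly_approx_horner.
by apply: poly_approxZ; exact: poly_approx_cexp.
Qed.

Lemma rest_mxE (R : realType) (N K : nat) (L : 'M[R[i]]_N)
    (A : 'I_K -> 'M[R[i]]_N) (tau : 'I_K -> R) (r : R) (z : R[i]) i j :
  rest_mx L A tau r z i j
    = L i j + \sum_(k < K) A k i j * cexp (- ((tau k)%:C / r%:C) * z).
Proof.
rewrite mxE summxE; congr (_ + _); apply: eq_bigr => k _; rewrite mxE mulrC.
by congr (_ * cexp _); ring.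
Qed.

Lemma poly_approx_rest_mx (R : realType) (N K : nat) (L : 'M[R[i]]_N)
    (A : 'I_K -> 'M[R[i]]_N) (tau : 'I_K -> R) (r : R) i j :
  poly_approx (fun z => rest_mx L A tau r z i j).
Proof.
have -> : (fun z => rest_mx L A tau r z i j) = (fun z => (L i j)%:P.[z]
    + \sum_(k < K) A k i j * cexp (- ((tau k)%:C / r%:C) * z)).
  by apply/funext => z; rewrite rest_mxE hornerC.
apply: poly_approxD; first exact: poly_approx_horner.
by apply: poly_approx_sum => k; apply: poly_approxZ; exact: poly_approx_cexp.
Qed.

(** For Re z >= 0 the delays only contribute factors of modulus at most 1, however
small r is: the bound is uniform in r. *)
Lemma rest_mx_bounded (R : realType) (N K : nat) (L : 'M[R[i]]_N)
    (A : 'I_K -> 'M[R[i]]_N) (tau : 'I_K -> R) :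
  (forall k, 0 <= tau k) ->
  exists2 D : R, 0 <= D & forall r z i j, 0 < r -> 0 <= complex.Re z ->
    cmod (rest_mx L A tau r z i j) <= D.
Proof.
move=> tau0; pose b i j := cmod (L i j) + \sum_k cmod (A k i j).
have b0 i j : 0 <= b i j.
  by rewrite addr_ge0 ?cmod_ge0// sumr_ge0// => k _; exact: cmod_ge0.
exists (\sum_i \sum_j b i j) => [|r z i j r0 rez].
  by do 2 (apply: sumr_ge0 => ? _).
apply: (@le_trans _ _ (b i j)); last first.
  rewrite (bigD1 i)//= (bigD1 j)//= -addrA lerDl addr_ge0//.
    by apply: sumr_ge0.
  by do 2 (apply: sumr_ge0 => ? _).
rewrite rest_mxE; apply: le_trans (cmod_le_add _ _) _; rewrite lerD2l.
apply: le_trans (cmod_sum _ _) _; apply: ler_sum => k _.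
rewrite cmodM cmod_cexp ler_piMr ?cmod_ge0// expR_le1.
rewrite -fmorphV -rmorphM/= -rmorphN/=; case: z rez => x y /= x0.
by rewrite mul0r subr0 mulNr oppr_le0 mulr_ge0// divr_ge0// ltW.
Qed.

Lemma det_perturbation_cvg (R : realType) (N K : nat) (I Mb L : 'M[R[i]]_N)
    (A : 'I_K -> 'M[R[i]]_N) (tau : 'I_K -> R) (M e : R) :
  (forall k, 0 <= tau k) -> 0 < e ->
  exists2 rhat : R, 0 < rhat & forall r z, 0 < r -> r < rhat ->
    0 <= complex.Re z -> cmod z <= M ->
    cmod (\det (limit_mx I Mb z - r%:C *: rest_mx L A tau r z)
          - \det (limit_mx I Mb z)) <= e.
Proof.
move=> tau0 e0; have [D D0 hD] := rest_mx_bounded L A tau0.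
have [B B0 hB] := poly_approx_entries_bounded M (poly_approx_limit_mx I Mb).
have [l l0 hl] := @det_lipschitz R N (B + D).
have lD : 0 < l * D + 1 by rewrite ltr_wpDl// mulr_ge0.
exists (Num.min 1 (e / (l * D + 1))); first by rewrite lt_min ltr01 divr_gt0.
move=> r z r0; rewrite lt_min (ltr_pdivlMr _ _ lD) => /andP[r1 r2] rez zM.
have rest_le i j : cmod (r%:C * rest_mx L A tau r z i j) <= r * D.
  by rewrite cmodM cmodR gtr0_norm// ler_pM2l// hD.
have entE i j : (limit_mx I Mb z - r%:C *: rest_mx L A tau r z) i j
    = limit_mx I Mb z i j - r%:C * rest_mx L A tau r z i j.
  by rewrite !mxE.
have rD : r * D <= D by rewrite ler_piMl// ltW.
apply: (@le_trans _ _ (l * (r * D))).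
  apply: hl => [|i j|i j|i j].
  - by rewrite mulr_ge0// ltW.
  - rewrite entE; apply: le_trans (cmod_le_sub _ _) _; apply: lerD.
      exact: hB.
    exact: le_trans (rest_le i j) rD.
  - by apply: le_trans (hB z i j zM) _; rewrite lerDl.
  - by rewrite entE addrAC subrr add0r cmodN.
have -> : l * (r * D) = r * (l * D) by ring.
by apply: le_trans (ltW r2); rewrite ler_pM2l// lerDl.
Qed.

(** The block q contributes the factor z^q, which does not vanish; a kernel vector
of z - s M is an eigenvector of M for z / s, and s = 0 would force z = 0. *)
Lemma limit_det_eq0 (R : realType) (n q : nat) (M : 'M[R[i]]_n) (z : R[i]) :
  z != 0 ->
  \det (limit_mx (block_mx (1%:M : 'M[R[i]]_n) 0 0 (1%:M : 'M[R[i]]_q))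
                 (block_mx M 0 0 0) z) = 0 <->
  exists2 t, eigenvalue M t & z = t * (1 - cexp (- z)).
Proof.
rewrite /limit_mx; set s := 1 - cexp (- z) => z0.
have -> : z *: block_mx (1%:M : 'M[R[i]]_n) 0 0 (1%:M : 'M[R[i]]_q)
      - s *: block_mx M 0 0 0
    = block_mx (z%:M - s *: M) 0 0 (z%:M : 'M[R[i]]_q).
  rewrite !scale_block_mx opp_block_mx add_block_mx !scaler0 !subr0.
  by rewrite !scalemx1.
rewrite det_ublock det_scalar; split.
  move=> /eqP; rewrite mulf_eq0 expf_eq0 (negbTE z0) andbF orbF.
  move=> /det0P[v v0]; rewrite mulmxBr mul_mx_scalar -scalemxAr => /eqP.
  rewrite subr_eq0 => /eqP vE.
  have s0 : s != 0.
    apply: contraNneq v0 => s0; move/eqP: vE.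
    by rewrite s0 scale0r scaler_eq0 (negbTE z0).
  exists (z / s); last by rewrite divfK.
  apply/eigenvalueP; exists v => //.
  by rewrite mulrC -scalerA vE scalerA mulVf// scale1r.
move=> [t /eigenvalueP[v vM v0] zE].
suff -> : \det (z%:M - s *: M) = 0 by rewrite mul0r.
apply/eqP/det0P; exists v => //.
by rewrite mulmxBr mul_mx_scalar -scalemxAr vM scalerA zE mulrC subrr.
Qed.

(** A zero z of the determinant near z0 makes t = z / (1 - e^-z) an eigenvalue of M
close to mu. The eigenvalues being finitely many, t = mu, and z is a root of the
equation whose roots are isolated. *)
Lemma limit_det_isolated (R : realType) (n q : nat) (M : 'M[R[i]]_n)
    (mu z0 : R[i]) :
  z0 != 0 -> z0 = mu * (1 - cexp (- z0)) ->
  exists2 d : R, 0 < d & forall z, cmod (z - z0) < d -> 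
    \det (limit_mx (block_mx (1%:M : 'M[R[i]]_n) 0 0 (1%:M : 'M[R[i]]_q))
                   (block_mx M 0 0 0) z) = 0 -> z = z0.
Proof.
move=> z00 z0E.
have [d1 d10 iso] := delay_root_isolated z0E.
have [d2 d20 eig] : exists2 d : R, 0 < d &
    forall t, root (char_poly M) t -> cmod (t - mu) < d -> t = mu.
  by apply: poly_root_isolated; rewrite monic_neq0// char_poly_monic.
pose s (z : R[i]) := 1 - cexp (- z); pose f z := z - mu * s z.
have pas : poly_approx s.
  have -> : s = (fun z => (1 : {poly R[i]}).[z] + (-1) * cexp ((-1) * z)).
    by apply/funext => z; rewrite hornerC !mulN1r.
  apply: poly_approxD; first exact: poly_approx_horner.
  by apply: poly_approxZ; exact: poly_approx_cexp.
have paf : poly_approx f.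
  have -> : f = (fun z => ('X : {poly R[i]}).[z] + (- mu) * s z).
    by apply/funext => z; rewrite hornerX mulNr.
  apply: poly_approxD; first exact: poly_approx_horner.
  exact: poly_approxZ.
have s00 : 0 < cmod (s z0).
  by rewrite cmod_gt0; apply: contraNneq z00 => s0; rewrite z0E -/(s z0) s0 mulr0.
have s20 : 0 < cmod (s z0) / 2 by rewrite divr_gt0.
have [d3 d30 cs] := poly_approx_continuous pas z0 s20.
have [d4 d40 cf] := poly_approx_continuous paf z0 (mulr_gt0 d20 s20).
have f0 : f z0 = 0 by rewrite /f {1}z0E subrr.
exists (Num.min (Num.min d1 (cmod z0)) (Num.min d3 d4)).
  by rewrite !lt_min d10 d30 d40 cmod_gt0 z00.
move=> z; rewrite !lt_min => /andP[/andP[zd1 zz0] /andP[/cs sz /cf fz]].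
have zn0 : z != 0.
  by apply: contraTneq zz0 => ->; rewrite sub0r cmodN ltxx.
move=> /(limit_det_eq0 _ _ zn0)[t]; rewrite eigenvalue_root_char => teig zt.
apply: iso => //; rewrite [LHS]zt; congr (_ * _).
apply: eig => //.
have {}sz : cmod (s z0) / 2 < cmod (s z).
  by have := cmod_sub_le (s z0) (s z); rewrite cmod_distC; lra.
move: fz; rewrite f0 subr0 /f {1}zt -/(s z) -mulrBl cmodM.
move=> /lt_trans h; rewrite -(ltr_pM2r (lt_trans s20 sz)).
by apply: h; rewrite ltr_pM2l.
Qed.

(** * Instability for a small difference step *)

Lemma charfun_fd_scaled (R : realType) (n m p q K : nat)
    (A0 : 'M[R]_n) (A : 'I_K -> 'M[R]_n) (tau : 'I_K -> R)
    (B : 'M[R]_(n, m)) (C : 'M[R]_(p, n)) (Kp Kd : 'M[R]_(m, p))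
    (U : 'M[R]_(m, q)) (V : 'M[R]_(q, p)) (r : R) (z : R[i]) :
  r != 0 ->
  r%:C ^+ (n + q) * charfun_fd A0 A tau B C Kp Kd U V r (z / r%:C)
  = \det (limit_mx (block_mx 1%:M 0 0 1%:M)
              (block_mx (cmx (B *m Kd *m C)) 0 0 (0 : 'M[R[i]]_q)) z
      - r%:C *: rest_mx (cmx (loop_mx A0 B C Kp U V))
                  (fun k => cmx (block_mx (A k) 0 0 (0 : 'M[R]_q))) tau r z).
Proof.
move=> r0; have rC : r%:C != 0 by rewrite fmorph_eq0.
have idE : cmx (block_mx (1%:M : 'M[R]_n) 0 0 (1%:M : 'M[R]_q))
    = block_mx 1%:M 0 0 1%:M by rewrite /cmx map_block_mx !map_mx0 !map_mx1.
have gainE : cmx (block_mx (B *m Kd *m C) 0 0 (0 : 'M[R]_q))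
    = block_mx (cmx (B *m Kd *m C)) 0 0 0 by rewrite /cmx map_block_mx !map_mx0.
have scale_mx (I Mb L S : 'M[R[i]]_(n + q)) (s : R[i]) :
    r%:C *: ((z / r%:C) *: I - (s / r%:C) *: Mb - L - S)
    = z *: I - s *: Mb - r%:C *: (L + S).
  by rewrite !scalerBr scalerDr opprD addrA !scalerA ![r%:C * _]mulrC !divfK.
rewrite /charfun_fd -detZ idE gainE scale_mx /delay_mx.
by rewrite [- (z / _) * r%:C]mulNr divfK.
Qed.

Theorem proposition3p2 (R : realType) (n m p K : nat)
    (A0 : 'M[R]_n) (A : 'I_K -> 'M[R]_n) (tau : 'I_K -> R)
    (B : 'M[R]_(n, m)) (C : 'M[R]_(p, n))
    (tau_gt0 : forall k : 'I_K, 0 < tau k)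
    (tau_incr : forall k l : 'I_K, (k < l)%N -> tau k < tau l)
    (B_full_col_rank : row_full B) (C_full_row_rank : row_free C)
    (Kp Kd Ki : 'M[R]_(m, p))
    (q : nat) (U : 'M[R]_(m, q)) (V : 'M[R]_(q, p))
    (rank_Ki : \rank Ki = q) (Ki_fact : Ki = U *m V)
    (U_full_col_rank : row_full U) (V_full_row_rank : row_free V)
    (pid_stable : exp_stable (charfun_pid A0 A tau B C Kp Kd U V))
    (eig_outside : exists2 mu : R[i],
       eigenvalue (cmx (B *m Kd *m C)) mu & ~ closure (@setS R) mu) :
  exists2 rhat : R, 0 < rhat &
    forall r : R, 0 < r -> r < rhat ->
      unstable (charfun_fd A0 A tau B C Kp Kd U V r).
Proof.
case: eig_outside => mu mu_eig /delay_root_right[z0 z0_re z0E].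
have z00 : z0 != 0 by apply: contraTneq z0_re => ->; rewrite ltxx.
pose M := cmx (B *m Kd *m C).
have [d d0 iso] := limit_det_isolated q M z00 z0E.
pose F z := limit_mx (block_mx (1%:M : 'M[R[i]]_n) 0 0 (1%:M : 'M[R[i]]_q))
              (block_mx M 0 0 0) z.
pose G r z := rest_mx (cmx (loop_mx A0 B C Kp U V))
                  (fun k => cmx (block_mx (A k) 0 0 (0 : 'M[R]_q))) tau r z.
(* The disc of radius rho isolates z0 and stays in the open right half-plane. *)
pose rho := Num.min (d / 2) (complex.Re z0 / 2).
have rho0 : 0 < rho by rewrite lt_min !divr_gt0.
have rhod : rho < d.
  by apply: (@le_lt_trans _ _ (d / 2)); [rewrite ge_min lexx|lra].
have disc_re z : cmod (z - z0) <= rho -> 0 < complex.Re z.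
  move=> zr; have := le_trans (le_Re_cmod _) zr.
  rewrite raddfB/= ler_norml => /andP[h _].
  have : rho <= complex.Re z0 / 2 by rewrite ge_min lexx orbT.
  by lra.
have [||||||rhat rhat0 hr] := @hurwitz_root R (fun z => \det (F z))
    (fun r z => \det (F z - r%:C *: G r z)) z0 rho => //.
- by apply: poly_approx_det => i j; exact: poly_approx_limit_mx.
- move=> r _; apply: poly_approx_det => i j.
  have -> : (fun z => (F z - r%:C *: G r z) i j)
      = (fun z => F z i j + (- r%:C) * G r z i j).
    by apply/funext => z; rewrite [LHS]mxE [X in _ + X]mxE [X in - X]mxE mulNr.
  apply: poly_approxD; first exact: poly_approx_limit_mx.
  by apply: poly_approxZ; exact: poly_approx_rest_mx.
- by apply/(limit_det_eq0 _ _ z00); exists mu.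
- move=> z zr; apply/eqP => /iso zz0.
  move: (zr); rewrite zz0 ?zr// subrr cmod0 => rho00.
  by rewrite -rho00 ltxx in rho0.
- move=> e e0.
  have [//|rhat rhat0 h] := @det_perturbation_cvg R (n + q) K
    (block_mx 1%:M 0 0 1%:M) (block_mx M 0 0 0) (cmx (loop_mx A0 B C Kp U V))
    (fun k => cmx (block_mx (A k) 0 0 (0 : 'M[R]_q))) tau (cmod z0 + rho) e
    (fun k => ltW (tau_gt0 k)).
  exists rhat => // r z r0 rr zr; apply: h => //; first exact/ltW/disc_re.
  by have := cmod_sub_le z z0; lra.
exists rhat => // r r0 rr; have [z /disc_re z_re Gz] := hr r r0 rr.
exists (z / r%:C).
  have rC : r%:C ^+ (n + q) != 0 by rewrite expf_neq0// fmorph_eq0 gt_eqF.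
  apply: (mulfI rC); rewrite mulr0 charfun_fd_scaled ?gt_eqF//.
rewrite -fmorphV mulrC; case: (z) z_re => x y /= x0.
by rewrite mul0r subr0 mulr_gt0// invr_gt0.
Qed.
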